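(* Let $G$ be a lim-free weakly hyperbolic group. Then $G$ does not contain any non-trivial proper normal subgroup that is closed in the Zariski topology on $G$.
   Context: A hyperbolic space is a geodesic metric space $S$ (not assumed proper) such that for some $\delta\ge 0$, $\langle x|y\rangle_o\ge\min\{\langle x|z\rangle_o,\langle z|y\rangle_o\}-\delta$ for all $x,y,z,o\in S$, where $\langle x|y\rangle_o=\frac12(d(x,o)+d(y,o)-d(x,y))$. Its Gromov boundary $\partial S$ is the set of equivalence classes of sequences $(x_i)$ in $S$ with $\langle x_i|x_j\rangle_o\to\infty$ as $i,j\to\infty$, where $(x_i)\sim(y_i)$ iff $\langle x_i|y_j\rangle_o\to\infty$; a sequence in the class $a$ is said to converge to $a$. For $a,b\in\partial S$, $\langle a|b\rangle_o$ is the infimum of $\liminf_{i,j}\langle x_i|y_j\rangle_o$ over sequences $x_i\to a$, $y_j\to b$; $\partial S$ is topologized so that the sets $\{b\in\partial S:\langle a|b\rangle_o>r\}$, $r\ge 0$, form a neighborhood base at $a$. All group actions on hyperbolic spaces are by isometries; they extend to actions by homeomorphisms on $\partial S$. The limit set $\Lambda_S(G)\subseteq\partial S$ of a group $G$ acting on $S$ is the set of points of $\partial S$ that are limits of sequences in an orbit $Gs$ (independent of $s\in S$), with the subspace topology. An element $g\in G$ is loxodromic if $\langle g\rangle$ has unbounded orbits in $S$ and fixes exactly two points of $\partial S$. The action of $G$ on $S$ is of general type if its orbits are unbounded and $G$ contains two loxodromic elements with disjoint fixed point sets in $\partial S$. An action by homeomorphisms on a topological space $X$ is topologically free if for every nontrivial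 element $g$ the set of fixed points of $g$ in $X$ has empty interior. A group is weakly hyperbolic if it admits a general type action on a hyperbolic space; it is lim-free if it admits a general type action on a hyperbolic space such that the induced action on the limit set is topologically free. For $w(t)\in G*\langle t\rangle$ (with $\langle t\rangle$ infinite cyclic) and $g\in G$, $w(g)\in G$ is the image of $w$ under the homomorphism $G*\langle t\rangle\to G$ that is the identity on $G$ and sends $t$ to $g$. The primitive solution set of $w(t)$ is $\{g\in G\mid w(g)=1\}$. The Zariski topology on $G$ is the topology for which the collection of primitive solution sets of all $w(t)\in G*\langle t\rangle$ is a subbasis for the closed sets. *)

(* Defs.v *)
From HB Require Import structures.
From mathcomp Require Import all_boot all_order all_algebra.
From mathcomp Require Import all_classical all_reals all_analysis.
From mathcomp Require Import zify.

Set Implicit Arguments.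
Unset Strict Implicit.
Unset Printing Implicit Defensive.

Import Order.TTheory GRing.Theory Num.Theory.
Import numFieldNormedType.Exports.

Local Open Scope classical_set_scope.
Local Open Scope ring_scope.

Section Groups.
Local Open Scope group_scope.
Variable G : groupType.

Definition normal_subgroup (N : set G) : Prop :=
  [/\ N 1,
      forall x y, N x -> N y -> N (x * y),
      forall x, N x -> N x^-1
    & forall x y, N x -> N (x ^ y)].

(* The library only has powers with exponents in nat. *)
Definition expgz (g : G) (n : int) : G :=
  match n with Posz m => g ^+ m | Negz m => g ^- m.+1 end.

Definition cyclic_subgroup (g : G) : set G := range (expgz g).

Lemma expgz_succ g (n : int) : expgz g (1 + n)%R = g * expgz g n.
Proof.
case: n => [m|[|m]]; rewrite /expgz.
- by rewrite -PoszD add1n expgS.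
- by rewrite NegzE subrr /= mulgV.
- have -> : (1 + Negz m.+1)%R = Negz m :> int by rewrite !NegzE; lia.
  by rewrite (expgSr g m.+1) invgM mulgA mulgV mul1g.
Qed.

Lemma expgz_pred g (n : int) : expgz g (- 1 + n)%R = g^-1 * expgz g n.
Proof.
have -> : expgz g n = g * expgz g (- 1 + n)%R.
  by rewrite -expgz_succ addrA subrr add0r.
by rewrite mulgA mulVg mul1g.
Qed.

Lemma expgzD g (m n : int) : expgz g (m + n)%R = expgz g m * expgz g n.
Proof.
elim/int_ind: m => [|m IHm|m IHm]; first by rewrite add0r mul1g.
- have -> : (m.+1%:Z)%R = (1 + m%:Z)%R by lia.
  by rewrite -addrA !expgz_succ IHm mulgA.
- have -> : (- m.+1%:Z)%R = (- 1 + - m%:Z)%R by lia.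
  by rewrite -addrA !expgz_pred IHm mulgA.
Qed.

End Groups.

Section FreeProduct.
Local Open Scope group_scope.
Variables G H : groupType.

Let word := seq (G + H).

Inductive word_equiv : word -> word -> Prop :=
  | word_equiv_refl u : word_equiv u u
  | word_equiv_sym u v : word_equiv u v -> word_equiv v u
  | word_equiv_trans u v w : word_equiv u v -> word_equiv v w -> word_equiv u w
  | word_equiv_cat u u' v v' :
      word_equiv u u' -> word_equiv v v' -> word_equiv (u ++ v) (u' ++ v')
  | word_equiv_1l : word_equiv [:: inl 1] [::]
  | word_equiv_1r : word_equiv [:: inr 1] [::]
  | word_equiv_Ml g g' : word_equiv [:: inl g; inl g'] [:: inl (g * g')]
  | word_equiv_Mr h h' : word_equiv [:: inr h; inr h'] [:: inr (h * h')].

Definition word_equivb : rel word := fun u v => `[< word_equiv u v >].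

Lemma word_equivb_equiv : equiv_class_of word_equivb.
Proof.
split=> [u|u v|v u w].
- exact/asboolP/word_equiv_refl.
- by apply/asboolP/asboolP => /word_equiv_sym.
- move=> /asboolP uv /asboolP vw; apply/asboolP; exact: word_equiv_trans vw.
Qed.

Canonical word_equivb_equiv_rel := EquivRelPack word_equivb_equiv.

Definition free_product : Type := {eq_quot word_equivb}%qT.
HB.instance Definition _ := Choice.on free_product.
HB.instance Definition _ : isQuotient word free_product :=
  Quotient.on free_product.

Definition fp_class (u : word) : free_product := (\pi_free_product u)%qT.

Lemma fp_classP u v : fp_class u = fp_class v <-> word_equiv u v.
Proof.
have E : reflect (fp_class u = fp_class v) (word_equivb u v).
  exact: (@eqmodP _ word_equivb_equiv_rel u v).
by split=> [/E/asboolP//|uv]; exact/E/asboolP.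
Qed.

Lemma fp_classK (x : free_product) : fp_class (repr x) = x.
Proof. exact: reprK. Qed.

Let letter_inv (a : G + H) : G + H :=
  match a with inl g => inl g^-1 | inr h => inr h^-1 end.
Let word_inv (u : word) : word := rev (map letter_inv u).

Definition fp_mul (x y : free_product) := fp_class (repr x ++ repr y).
Definition fp_inv (x : free_product) := fp_class (word_inv (repr x)).

Lemma fp_class_repr u : word_equiv (repr (fp_class u)) u.
Proof. by apply/fp_classP; rewrite fp_classK. Qed.

Lemma fp_class_cat u v : fp_mul (fp_class u) (fp_class v) = fp_class (u ++ v).
Proof. by apply/fp_classP/word_equiv_cat; exact: fp_class_repr. Qed.

Lemma fp_mulA : associative fp_mul.
Proof.
move=> x y z; rewrite -(fp_classK x) -(fp_classK y) -(fp_classK z).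
move: (repr x) (repr y) (repr z) => u v w.
by rewrite (fp_class_cat v w) (fp_class_cat u v) (fp_class_cat u)
  (fp_class_cat (u ++ v)) catA.
Qed.

Lemma fp_mul1 : left_id (fp_class [::]) fp_mul.
Proof. by move=> x; rewrite -(fp_classK x) fp_class_cat. Qed.

Lemma fp_mulr1 : right_id (fp_class [::]) fp_mul.
Proof. by move=> x; rewrite -(fp_classK x) fp_class_cat cats0. Qed.

Let word_invl u : word_equiv (word_inv u ++ u) [::].
Proof.
elim: u => [|a u IHu]; first exact: word_equiv_refl.
rewrite /word_inv /= rev_cons cat_rcons.
apply: word_equiv_trans IHu; apply: word_equiv_cat; first exact: word_equiv_refl.
apply: (@word_equiv_cat [:: letter_inv a; a] [::]); last exact: word_equiv_refl.
case: a => [g|h] /=.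
- apply: word_equiv_trans (word_equiv_Ml _ _) _; rewrite mulVg.
  exact: word_equiv_1l.
- apply: word_equiv_trans (word_equiv_Mr _ _) _; rewrite mulVg.
  exact: word_equiv_1r.
Qed.

Let word_invK u : word_inv (word_inv u) = u.
Proof.
rewrite /word_inv map_rev revK -map_comp -[RHS]map_id.
by apply: eq_map => -[g|h] /=; rewrite invgK.
Qed.

Lemma fp_mulV : left_inverse (fp_class [::]) fp_inv fp_mul.
Proof.
move=> x; rewrite /fp_inv -[X in fp_mul _ X]fp_classK fp_class_cat.
exact/fp_classP/word_invl.
Qed.

Lemma fp_mulrV : right_inverse (fp_class [::]) fp_inv fp_mul.
Proof.
move=> x; rewrite /fp_inv -[X in fp_mul X _]fp_classK fp_class_cat.
by apply/fp_classP; rewrite -{1}[repr x]word_invK; exact: word_invl.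
Qed.

HB.instance Definition _ :=
  isGroup.Build free_product fp_mulA fp_mul1 fp_mulr1 fp_mulV fp_mulrV.

Definition fp_inl (g : G) : free_product := fp_class [:: inl g].
Definition fp_inr (h : H) : free_product := fp_class [:: inr h].

Lemma fp_inlM : {morph fp_inl : x y / x * y}.
Proof.
move=> x y; rewrite [RHS]fp_class_cat.
exact/fp_classP/word_equiv_sym/word_equiv_Ml.
Qed.

Lemma fp_inrM : {morph fp_inr : x y / x * y}.
Proof.
move=> x y; rewrite [RHS]fp_class_cat.
exact/fp_classP/word_equiv_sym/word_equiv_Mr.
Qed.

HB.instance Definition _ := isMultiplicative.Build G free_product fp_inl fp_inlM.
HB.instance Definition _ := isMultiplicative.Build H free_product fp_inr fp_inrM.

Section Lift.
Variables (K : groupType).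
Variables (f : {multiplicative G -> K}) (h : {multiplicative H -> K}).

Let letter_lift (a : G + H) : K :=
  match a with inl x => f x | inr y => h y end.
Let word_lift (u : word) : K := foldr (fun a k => letter_lift a * k) 1 u.

Let word_lift_cat u v : word_lift (u ++ v) = word_lift u * word_lift v.
Proof. by elim: u => [|a u IHu] /=; rewrite ?mul1g// IHu mulgA. Qed.

Let mult1 (L : groupType) (p : {multiplicative L -> K}) : p 1 = 1.
Proof. by apply: (mulgI (p 1)); rewrite -gmulfM !mulg1. Qed.

Let word_lift_equiv u v : word_equiv u v -> word_lift u = word_lift v.
Proof.
elim=> {u v} //=.
- by move=> u v w _ -> _ ->.
- by move=> u u' v v' _ uu' _ vv'; rewrite !word_lift_cat uu' vv'.
- by rewrite mult1 mulg1.
- by rewrite mult1 mulg1.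
- by move=> x y; rewrite gmulfM !mulg1.
- by move=> x y; rewrite gmulfM !mulg1.
Qed.

(* The homomorphism given by the universal property of the free product. *)
Definition fp_lift (x : free_product) : K := word_lift (repr x).

Let fp_lift_class u : fp_lift (fp_class u) = word_lift u.
Proof. exact/word_lift_equiv/fp_class_repr. Qed.

Lemma fp_liftM : {morph fp_lift : x y / x * y}.
Proof.
move=> x y; rewrite -(fp_classK x) -(fp_classK y) [X in fp_lift X]fp_class_cat.
by rewrite !fp_lift_class word_lift_cat.
Qed.

HB.instance Definition _ := isMultiplicative.Build free_product K fp_lift fp_liftM.

Lemma fp_lift_inl x : fp_lift (fp_inl x) = f x.
Proof. by rewrite fp_lift_class /= mulg1. Qed.

Lemma fp_lift_inr y : fp_lift (fp_inr y) = h y.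
Proof. by rewrite fp_lift_class /= mulg1. Qed.

Lemma fp_lift_unique (p : {multiplicative free_product -> K}) :
  p \o fp_inl =1 f -> p \o fp_inr =1 h -> p =1 fp_lift.
Proof.
move=> pf ph x; rewrite -(fp_classK x) fp_lift_class.
elim: (repr x) => [|a u IHu] /=; first by rewrite -(mult1 p).
rewrite -cat1s -fp_class_cat gmulfM IHu; congr (_ * _).
by case: a => [y|y] /=; rewrite -?pf -?ph.
Qed.

End Lift.
End FreeProduct.

(* The infinite cyclic group [<t>], with [n] standing for [t ^ n]. *)
Definition infinite_cyclic : Type := int.
HB.instance Definition _ := Choice.on infinite_cyclic.
HB.instance Definition _ := isGroup.Build infinite_cyclic
  (@addrA int) (@add0r int) (@addr0 int) (@addNr int) (@addrN int).

Section Zariski.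
Local Open Scope group_scope.
Variable G : groupType.

Definition power_map (g : G) : infinite_cyclic -> G := expgz g.
HB.instance Definition _ (g : G) :=
  isMultiplicative.Build infinite_cyclic G (power_map g) (expgzD g).

(* [word_eval g w] is [w(g)]. *)
Definition word_eval (g : G) (w : free_product G infinite_cyclic) : G :=
  fp_lift (idfun : {multiplicative G -> G})
          (power_map g : {multiplicative infinite_cyclic -> G}) w.

Definition primitive_solution_set (w : free_product G infinite_cyclic) : set G :=
  [set g | word_eval g w = 1].

Definition zariski : Type := G.
HB.instance Definition _ := Choice.on zariski.

HB.instance Definition _ :=
  isPointed.Build (free_product G infinite_cyclic) 1.

(* A subbasis for the closed sets amounts to the subbasis for the open sets
   formed by the complements. *)
HB.instance Definition _ := @isSubBaseTopological.Build zariski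
  (free_product G infinite_cyclic) setT
  (fun w => ~` primitive_solution_set w).

End Zariski.

Section Actions.
Local Open Scope group_scope.

Record group_action (G : groupType) (X : Type) := GroupAction {
  act :> G -> X -> X;
  act1 : forall x, act 1 x = x;
  actM : forall g h x, act (g * h) x = act g (act h x) }.

Definition orbit G X (alpha : group_action G X) (A : set G) (x : X) : set X :=
  [set alpha g x | g in A].

Definition fixed_points G X (alpha : group_action G X) (A : set G) : set X :=
  [set x | forall g, A g -> alpha g x = x].

Record homeo_action (G : groupType) (X : topologicalType) := HomeoAction {
  homeo_act :> group_action G X;
  homeo_actP : forall g, continuous (homeo_act g) }.

Definition topologically_free G X (alpha : homeo_action G X) : Prop :=
  forall g, g <> 1 -> (fixed_points alpha [set g])^° = set0.

Record isometric_action (R : realType) (G : groupType) (S : metricType R) :=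
  IsometricAction {
    isometric_act :> group_action G S;
    isometric_actP : forall g x y,
      mdist (isometric_act g x) (isometric_act g y) = mdist x y }.

End Actions.

Section Hyperbolic.
Variables (R : realType) (S : metricType R).

Definition geodesic_space : Prop :=
  forall x y : S, exists c : R -> S,
    [/\ c 0 = x, c (mdist x y) = y
      & forall s t, 0 <= s <= mdist x y -> 0 <= t <= mdist x y ->
          mdist (c s) (c t) = `|s - t|].

Definition gromov_product (o x y : S) : R :=
  (mdist x o + mdist y o - mdist x y) / 2.

Definition hyperbolic_space : Prop :=
  geodesic_space /\
  exists2 delta : R, 0 <= delta & forall x y z o : S,
    Num.min (gromov_product o x z) (gromov_product o z y) - delta
      <= gromov_product o x y.

Definition metric_bounded (A : set S) : Prop :=
  exists M : R, forall x y, A x -> A y -> mdist x y <= M.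

(* [<x_i|y_j>_o] tends to infinity as [i, j] do; this does not depend on [o]. *)
Definition product_to_infty (x y : nat -> S) : Prop :=
  forall o, gromov_product o (x ij.1) (y ij.2) @[ij --> (\oo, \oo)] --> +oo.

(* A point of the Gromov boundary is an equivalence class of sequences, given
   as the set of the sequences in it. *)
Record boundary := Boundary {
  bclass : set (nat -> S);
  bclassP : exists2 x, product_to_infty x x &
    bclass = [set y | product_to_infty y y /\ product_to_infty x y] }.

HB.instance Definition _ := gen_eqMixin boundary.
HB.instance Definition _ := gen_choiceMixin boundary.

Lemma bclass_inj : injective bclass.
Proof.
move=> [A Ap] [B Bp] /= AB; rewrite AB in Ap *.
by congr Boundary; exact: Prop_irrelevance.
Qed.

Definition converges_to (x : nat -> S) (a : boundary) : Prop := bclass a x.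

Definition boundary_product (o : S) (a b : boundary) : \bar R :=
  ereal_inf [set l | exists x y, [/\ converges_to x a, converges_to y b &
    l = limf_einf (fun ij => (gromov_product o (x ij.1) (y ij.2))%:E)
          (filter_prod \oo \oo)]].

Definition boundary_nbhd (o : S) (r : R) (a : boundary) : set boundary :=
  [set b | (r%:E < boundary_product o a b)%E].

(* A topology for which the sets [boundary_nbhd o r a] form a neighborhood base
   at [a] has exactly these open sets. The choice of [o] does not matter. *)
Definition boundary_open (U : set boundary) : Prop :=
  forall a, U a -> forall o, exists2 r, 0 <= r & boundary_nbhd o r a `<=` U.

Lemma boundary_openT : boundary_open setT.
Proof. by move=> a _ o; exists 0. Qed.

Lemma boundary_openI : setI_closed boundary_open.
Proof.
move=> U V oU oV a [Ua Va] o.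
have [r r0 rU] := oU a Ua o; have [s s0 sV] := oV a Va o.
exists (Num.max r s); first by rewrite le_max r0.
move=> b; rewrite /boundary_nbhd /= => rsb; split.
- by apply: rU; apply: le_lt_trans rsb; rewrite lee_fin le_max lexx.
- by apply: sV; apply: le_lt_trans rsb; rewrite lee_fin le_max lexx orbT.
Qed.

Lemma boundary_open_bigU (I : Type) (f : I -> set boundary) :
  (forall i, boundary_open (f i)) -> boundary_open (\bigcup_i f i).
Proof.
move=> of_ a [i _ fia] o; have [r r0 rf] := of_ i a fia o.
by exists r => // b /rf fib; exists i.
Qed.

HB.instance Definition _ := isOpenTopological.Build boundary
  boundary_openT boundary_openI boundary_open_bigU.

Lemma boundary_openE : open = boundary_open.
Proof. by []. Qed.

End Hyperbolic.

Section BoundaryAction.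
Variables (R : realType) (G : groupType) (S : metricType R).
Variable alpha : isometric_action G S.

Let alphaK g : cancel (alpha g) (alpha g^-1%g).
Proof. by move=> x; rewrite -actM mulVg act1. Qed.
Let alphaVK g : cancel (alpha g^-1%g) (alpha g).
Proof. by move=> x; rewrite -actM mulgV act1. Qed.
Let alphaVKseq g (x : nat -> S) : alpha g \o (alpha g^-1%g \o x) = x.
Proof. by apply/funext => n /=; rewrite alphaVK. Qed.
Let alphaKseq g (x : nat -> S) : alpha g^-1%g \o (alpha g \o x) = x.
Proof. by apply/funext => n /=; rewrite alphaK. Qed.

Lemma gromov_product_act g o x y :
  gromov_product (alpha g o) (alpha g x) (alpha g y) = gromov_product o x y.
Proof. by rewrite /gromov_product !isometric_actP. Qed.

Lemma product_to_infty_act g (x y : nat -> S) :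
  product_to_infty x y -> product_to_infty (alpha g \o x) (alpha g \o y).
Proof.
move=> xy o; rewrite -(alphaVK g o).
by under eq_fun do rewrite /= gromov_product_act; exact: xy.
Qed.

Lemma bclass_act g (a : boundary S) :
  exists2 x, product_to_infty x x &
    [set alpha g \o y | y in bclass a] =
    [set y | product_to_infty y y /\ product_to_infty x y].
Proof.
have [x xx ->] := bclassP a.
exists (alpha g \o x); first exact: product_to_infty_act.
apply/seteqP; split=> [_ [y [yy xy] <-]|y [yy xy]] /=.
  by split; exact: product_to_infty_act.
exists (alpha g^-1%g \o y) => //; split; first exact: product_to_infty_act.
by rewrite -(alphaKseq g x); exact: product_to_infty_act.
Qed.

Definition boundary_act (g : G) (a : boundary S) : boundary S :=
  Boundary (bclass_act g a).

Lemma boundary_act1 a : boundary_act 1%g a = a.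
Proof.
apply: bclass_inj => /=; rewrite -[RHS]image_id; congr image.
by apply/funext => y; apply: (@funext nat S) => n /=; rewrite act1.
Qed.

Lemma boundary_actM g h a :
  boundary_act (g * h)%g a = boundary_act g (boundary_act h a).
Proof.
apply: bclass_inj => /=; rewrite [RHS]image_comp; congr image.
by apply/funext => y; apply: (@funext nat S) => n /=; rewrite actM.
Qed.

Definition boundary_group_action : group_action G (boundary S) :=
  GroupAction boundary_act1 boundary_actM.

Lemma boundary_product_act g o a b :
  boundary_product (alpha g o) (boundary_act g a) (boundary_act g b) =
  boundary_product o a b.
Proof.
congr ereal_inf; apply/seteqP; split=> [_ [_ [_ [[x ax <-] [y by_ <-] ->]]]|].
  exists x, y; split=> //; congr limf_einf.
  by apply/funext => ij /=; rewrite gromov_product_act.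
move=> _ [x [y [ax by_ ->]]]; exists (alpha g \o x), (alpha g \o y).
split; [by exists x|by exists y|congr limf_einf].
by apply/funext => ij /=; rewrite gromov_product_act.
Qed.

Lemma boundary_act_continuous g : continuous (boundary_act g).
Proof.
apply/continuousP => U; rewrite boundary_openE => oU a /= Uga o.
have [r r0 rU] := oU _ Uga (alpha g o); exists r => // b ab; apply: rU.
by rewrite /boundary_nbhd /= boundary_product_act.
Qed.

Definition boundary_action : homeo_action G (boundary S) :=
  @HomeoAction G (boundary S) boundary_group_action boundary_act_continuous.

Definition limit_set : set (boundary S) :=
  [set a | exists s (x : nat -> S),
    (forall n, orbit alpha setT s (x n)) /\ converges_to x a].

Lemma limit_set_act g a : limit_set a -> limit_set (boundary_act g a).
Proof.
move=> [s [x [xs xa]]]; exists s, (alpha g \o x); split; last by exists x.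
by move=> n /=; have [h _ <-] := xs n; exists (g * h)%g; rewrite ?actM.
Qed.

Definition limit_act (g : G) (a : limit_set) : limit_set :=
  exist _ (boundary_act g (val a)) (mem_set (limit_set_act g (set_valP a))).

Lemma limit_act1 a : limit_act 1%g a = a.
Proof. by apply: val_inj; exact: boundary_act1. Qed.

Lemma limit_actM g h a : limit_act (g * h)%g a = limit_act g (limit_act h a).
Proof. by apply: val_inj; exact: boundary_actM. Qed.

Definition limit_group_action : group_action G limit_set :=
  GroupAction limit_act1 limit_actM.

Lemma limit_act_continuous g : continuous (limit_act g).
Proof.
apply/continuousP => _ [U oU <-]; exists (boundary_act g @^-1` U) => //.
by apply: open_comp => // x _; exact: boundary_act_continuous.
Qed.

Definition limit_action : homeo_action G limit_set :=
  @HomeoAction G limit_set limit_group_action limit_act_continuous.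

Definition loxodromic (g : G) : Prop :=
  (forall s, ~ metric_bounded (orbit alpha (cyclic_subgroup g) s)) /\
  exists a b, a <> b /\
    fixed_points boundary_action (cyclic_subgroup g) = [set a; b].

Definition general_type : Prop :=
  (forall s, ~ metric_bounded (orbit alpha setT s)) /\
  exists g h, [/\ loxodromic g, loxodromic h &
    fixed_points boundary_action [set g] `&`
    fixed_points boundary_action [set h] = set0].

End BoundaryAction.

Definition weakly_hyperbolic (R : realType) (G : groupType) : Prop :=
  exists (S : metricType R) (alpha : isometric_action G S),
    hyperbolic_space S /\ general_type alpha.

Definition lim_free (R : realType) (G : groupType) : Prop :=
  exists (S : metricType R) (alpha : isometric_action G S),
    [/\ hyperbolic_space S, general_type alpha &
        topologically_free (limit_action alpha)].

(* Main.v *)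
Require Import Defs.
From mathcomp Require Import all_boot all_order all_algebra.
From mathcomp Require Import all_classical all_reals all_analysis.
From mathcomp Require Import lra.
Local Open Scope classical_set_scope.

Set Implicit Arguments.
Unset Strict Implicit.
Unset Printing Implicit Defensive.

Import Order.TTheory GRing.Theory Num.Theory.

(* A set closed in the Zariski topology that misses a point x is contained in
   the union of the solution sets of finitely many words w_i with w_i(x) <> 1, so
   it suffices to find g in the normal subgroup N with w_i(g) <> 1 for all i. We
   take g = t n t^-1 n^-1 with n in N outside a finite set and t moving points
   far along a loxodromic axis. Written in t, each w_i(g) becomes a product
   in which t and t^-1 alternate, separated by elements c of a finite set B not
   containing 1; it is nontrivial by ping-pong as soon as no c in B fixes an
   endpoint of the axis. Such an axis exists: by topological freeness the points
   of the limit set moved by all of B form a nonempty open set U. Let xi in U be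
   the limit of g_k s, and let f, h be loxodromic elements without common fixed
   points. The points g_k^-1 s cannot be close both to an endpoint of f and to an
   endpoint of h, and when they stay away from both endpoints of f, say, g_k maps
   these two endpoints close to xi, hence into U. *)

(** * Gromov products and sequences tending to infinity *)

Section GromovProduct.
Variables (R : realType) (S : metricType R).
Local Open Scope ring_scope.
Implicit Types (o x y z : S) (K : R) (p q : nat -> S) (a : boundary S).

Local Notation gp := gromov_product.

Lemma gromov_productC o x y : gromov_product o x y = gromov_product o y x.
Proof. by rewrite /gromov_product (metric_sym x y) (addrC (mdist x o)). Qed.

(** In the comparison tripod these are the two pieces of the side from [o] to [y]. When that side is
    long, a small product seen from one end is a large one seen from the other. *)
Lemma gromov_product_swap o x y :
  gromov_product o x y + gromov_product y x o = mdist o y.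
Proof.
rewrite /gromov_product (metric_sym o y) (metric_sym x y).
by move: (mdist x o) (mdist y o) (mdist y x) => u v w; lra.
Qed.

Lemma gromov_product_le_mdist o x y : gromov_product o x y <= mdist y o.
Proof.
have := metric_triangle x y o.
by rewrite /gromov_product; move: (mdist x o) => u; lra.
Qed.

Lemma gromov_product_base o o' x y :
  gromov_product o x y <= gromov_product o' x y + mdist o o'.
Proof.
have := metric_triangle x o' o; have := metric_triangle y o' o.
rewrite /gromov_product (metric_sym o o').
by move: (mdist x y) => u; lra.
Qed.

(** A change of base point alters products by a bounded amount, so a single [o] suffices. *)
Lemma product_to_inftyP o p q : product_to_infty p q <->
  forall K, exists n, forall i j, (n <= i)%N -> (n <= j)%N -> K <= gp o (p i) (q j).
Proof.
split=> [pq K|pq o'].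
  have /cvgryPge/(_ K)[[A B] /= [[n _ An] [m _ Bm]] AB] := pq o.
  exists (maxn n m) => i j; rewrite !geq_max => /andP[ni _] /andP[_ mj].
  by apply: (AB (i, j)); split; [exact: An|exact: Bm].
apply/cvgryPge => K; have [n pqn] := pq (K + mdist o o').
exists ([set i | (n <= i)%N], [set i | (n <= i)%N]) => /=.
  by split; exists n.
move=> [i j] /= [ni nj]; have := pqn i j ni nj.
have := gromov_product_base o o' (p i) (q j); lra.
Qed.

Lemma converges_self a p : converges_to p a -> product_to_infty p p.
Proof. by rewrite /converges_to; have [x _ ->] := bclassP a; case. Qed.

Lemma converges_ex a : exists p, converges_to p a.
Proof.
by have [x xx E] := bclassP a; exists x; rewrite /converges_to E.
Qed.

Lemma product_to_infty_sym p q : product_to_infty p q -> product_to_infty q p.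
Proof.
move=> pq; have o : S := p 0%N.
apply/(product_to_inftyP o) => K; have [n pqn] := (product_to_inftyP o p q).1 pq K.
by exists n => i j ni nj; rewrite gromov_productC; exact: pqn.
Qed.

End GromovProduct.

(** * Convergence to boundary points under the hyperbolic inequality *)

Section Hyperbolicity.
Variables (R : realType) (S : metricType R) (delta : R).
Local Open Scope ring_scope.
Hypothesis delta_ge0 : 0 <= delta.
Hypothesis hyperbolic : forall x y z o : S,
  Num.min (gromov_product o x z) (gromov_product o z y) - delta
    <= gromov_product o x y.
Implicit Types (o x y z : S) (K : R) (p q : nat -> S) (a b : boundary S).

Local Notation gp := gromov_product.

Lemma hyperbolic_ge o x y z K :
  K <= gp o x z -> K <= gp o z y -> K - delta <= gp o x y.
Proof.
move=> xz zy; apply: le_trans (hyperbolic x y z o).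
by rewrite lerB// le_min xz.
Qed.

Lemma hyperbolic_le o x y z K :
  gp o x y <= K -> gp o x z <= K + delta \/ gp o z y <= K + delta.
Proof.
move=> xy; have := hyperbolic x y z o.
by rewrite /Num.min; case: ifP => _ h; [left|right]; lra.
Qed.

Lemma product_to_infty_trans p q r :
  product_to_infty p q -> product_to_infty q r -> product_to_infty p r.
Proof.
move=> pq qr; have o : S := p 0%N; apply/(product_to_inftyP o) => K.
have [n pqn] := (product_to_inftyP o p q).1 pq (K + delta).
have [m qrm] := (product_to_inftyP o q r).1 qr (K + delta).
exists (maxn n m) => i j; rewrite !geq_max => /andP[ni mi] /andP[nj mj].
have := hyperbolic_ge (pqn i i ni ni) (qrm i j mi mj); lra.
Qed.

Lemma converges_product a p q :
  converges_to p a -> converges_to q a -> product_to_infty p q.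
Proof.
rewrite /converges_to; have [x _ ->] := bclassP a => -[_ xp] [_ xq].
exact: product_to_infty_trans (product_to_infty_sym xp) xq.
Qed.

Lemma converges_class a p q :
  converges_to p a -> product_to_infty q q -> product_to_infty p q ->
  converges_to q a.
Proof.
rewrite /converges_to; have [x _ ->] := bclassP a => -[_ xp] qq pq.
by split=> //; exact: product_to_infty_trans pq.
Qed.

Lemma converges_uniq a b p q :
  converges_to p a -> converges_to q b -> product_to_infty p q -> a = b.
Proof.
move=> pa qb pq; apply: bclass_inj; apply/seteqP; split=> r ra.
  apply: (converges_class qb (converges_self ra)).
  apply: product_to_infty_trans (product_to_infty_sym pq) _.
  exact: converges_product ra.
apply: (converges_class pa (converges_self ra)).
by apply: product_to_infty_trans pq _; exact: converges_product ra.
Qed.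

Lemma converges_near o a p q K :
  converges_to p a -> converges_to q a -> \forall i \near \oo, K <= gp o (p i) (q i).
Proof.
move=> pa qa; have pq := converges_product pa qa.
have [n pqn] := (product_to_inftyP o p q).1 pq K.
by exists n => // i /= ni; exact: pqn.
Qed.

(** Otherwise [p i] and [q i] have large products for arbitrarily late [i]; as each sequence
    converges, this spreads to all late pairs of indices and forces [a = b]. *)
Lemma boundary_separated o a b p q : a <> b ->
  converges_to p a -> converges_to q b ->
  exists C, \forall i \near \oo, gp o (p i) (q i) <= C.
Proof.
move=> ab pa qb; apply: contrapT => pqN; apply: ab.
apply: (converges_uniq pa qb); apply/(product_to_inftyP o) => K.
have [n ppn] := (product_to_inftyP o p p).1 (converges_self pa) (K + 2 * delta).
have [m qqm] := (product_to_inftyP o q q).1 (converges_self qb) (K + 2 * delta).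
have [i [ni mi pqi]] : exists i, [/\ (n <= i)%N, (m <= i)%N &
    K + 2 * delta <= gp o (p i) (q i)].
  apply: contrapT => N; apply: pqN; exists (K + 2 * delta).
  exists (maxn n m) => // i /=; rewrite geq_max => /andP[ni mi].
  by rewrite leNgt; apply/negP => /ltW ?; apply: N; exists i.
exists (maxn n m) => j k; rewrite !geq_max => /andP[nj mj] /andP[nk mk].
(* The chain [p j], [p i], [q i], [q k] uses the inequality twice, hence the margin [2 * delta]. *)
have pjqi := hyperbolic_ge (ppn j i nj ni) pqi.
have qqik : K + 2 * delta - delta <= gp o (q i) (q k).
  by have := qqm i k mi mk; move: delta_ge0; lra.
have := hyperbolic_ge pjqi qqik; lra.
Qed.

Lemma converges_change_ge o a p q z K :
  converges_to p a -> converges_to q a ->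
  (\forall i \near \oo, K <= gp o (p i) z) ->
  \forall i \near \oo, K - delta <= gp o (q i) z.
Proof.
move=> pa qa pz; have qp := converges_near o K qa pa.
by near=> i; apply: (@hyperbolic_ge _ _ _ (p i)); near: i.
Unshelve. all: by end_near. Qed.

Lemma converges_change_le o a p q z K :
  converges_to p a -> converges_to q a ->
  (\forall i \near \oo, gp o (p i) z <= K) ->
  \forall i \near \oo, gp o (q i) z <= K + delta.
Proof.
move=> pa qa pz; have pq := converges_near o (K + delta + 1) pa qa.
near=> i.
have [|//] : gp o (p i) (q i) <= K + delta \/ gp o (q i) z <= K + delta.
  by apply: hyperbolic_le; near: i.
have : K + delta + 1 <= gp o (p i) (q i) by near: i.
lra.
Unshelve. all: by end_near. Qed.

(** Late terms of [p] have large products with each other, so one late term with a small product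
    with [z] imposes a bound on all late terms. *)
Lemma converges_dichotomy o a p z K : converges_to p a ->
  (\forall i \near \oo, gp o (p i) z <= K + delta) \/
  (\forall i \near \oo, K < gp o (p i) z).
Proof.
move=> pa.
have [n ppn] := (product_to_inftyP o p p).1 (converges_self pa) (K + delta + 1).
have [[i ni pi]|N] := pselect (exists2 i, (n <= i)%N & gp o (p i) z <= K).
  left; exists n => // j /= nj.
  by have [|//] := hyperbolic_le (p j) pi; have := ppn i j ni nj; lra.
right; exists n => // i /= ni; rewrite ltNge; apply/negP => ?.
by apply: N; exists i.
Qed.

(** Passing to arbitrary representatives costs one [delta], and joining them through [z] costs
    another. *)
Lemma boundary_product_ge o a b p q z K :
  converges_to p a -> converges_to q b ->
  (\forall i \near \oo, K <= gp o (p i) z) ->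
  (\forall i \near \oo, K <= gp o (q i) z) ->
  ((K - 2 * delta)%:E <= boundary_product o a b)%E.
Proof.
move=> pa qb pz qz; apply: le_ereal_inf_tmp => _ [x [y [xa yb ->]]].
rewrite limf_einfE.
have xz := converges_change_ge pa xa pz; have yz := converges_change_ge qb yb qz.
apply: le_ereal_sup_tmp.
exists (ereal_inf [set (gp o (x ij.1) (y ij.2))%:E | ij in
   [set i | K - delta <= gp o (x i) z] `*` [set i | K - delta <= gp o (y i) z]]).
  exists ([set i | K - delta <= gp o (x i) z] `*` [set i | K - delta <= gp o (y i) z]) => //.
  by exists ([set i | K - delta <= gp o (x i) z], [set i | K - delta <= gp o (y i) z]).
apply: le_ereal_inf_tmp => _ [[i j] /= [xi yj] <-]; rewrite lee_fin.
rewrite gromov_productC in yj; have := hyperbolic_ge xi yj; lra.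
Qed.

Lemma boundary_product_gt o a b p q K :
  converges_to p a -> converges_to q b ->
  (K%:E < boundary_product o a b)%E ->
  \forall i \near \oo, K <= gp o (p i) (q i).
Proof.
move=> pa qb /lt_le_trans ab.
have /ab : (boundary_product o a b <= limf_einf
    (fun ij => (gp o (p ij.1) (q ij.2))%:E) (filter_prod \oo \oo))%E.
  by apply: ereal_inf_lbound; exists p, q.
rewrite limf_einfE => /ereal_sup_gt[_ [V [[A B] /= [Aoo Boo] ABV] <-]] KV.
near=> i; rewrite -lee_fin; apply: le_trans (ltW KV) _.
apply: ereal_inf_lbound; exists (i, i) => //.
by apply: ABV; split; rewrite /=; near: i.
Unshelve. all: by end_near. Qed.

(** * Isometries acting on the boundary *)

Section Action.
Variables (G : groupType) (alpha : isometric_action G S).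
Implicit Types (g h c : G) (t : nat -> G).

Local Notation bact := (boundary_act alpha).

Lemma converges_act g p a :
  converges_to p a -> converges_to (fun k => alpha g (p k)) (bact g a).
Proof. by exists p. Qed.

Lemma gromov_product_actV g o x y :
  gp o (alpha g x) (alpha g y) = gp (alpha g^-1%g o) x y.
Proof. by rewrite -[RHS](gromov_product_act alpha g) -actM mulgV act1. Qed.

Lemma mdist_actV g o : mdist o (alpha g^-1%g o) = mdist o (alpha g o).
Proof. by rewrite -[LHS](isometric_actP alpha g) -actM mulgV act1 metric_sym. Qed.

Lemma converges_from_near o p q a : converges_to p a ->
  (forall k, \forall i \near \oo, k%:R <= gp o (p i) (q k)) ->
  converges_to q a.
Proof.
move=> pa pq.
have archi K : exists n, forall k, (n <= k)%N -> K <= k%:R :> R.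
  exists (Num.truncn `|K|).+1 => k nk; apply: le_trans (ler_norm K) _.
  by apply: le_trans (ltW (truncnS_gt _)) _; rewrite ler_nat.
apply: (converges_class pa).
  apply/(product_to_inftyP o) => K; have [n nK] := archi (K + delta).
  exists n => i j ni nj; near \oo => m.
  have qi : K + delta <= gp o (q i) (p m).
    by rewrite gromov_productC; apply: le_trans (nK i ni) _; near: m.
  have qj : K + delta <= gp o (p m) (q j).
    by apply: le_trans (nK j nj) _; near: m.
  have := hyperbolic_ge qi qj; lra.
apply/(product_to_inftyP o) => K; have [n nK] := archi (K + delta).
have [m ppm] := (product_to_inftyP o p p).1 (converges_self pa) (K + delta).
exists (maxn n m) => i j; rewrite !geq_max => /andP[_ mi] /andP[nj _].
near \oo => l.
have pl : K + delta <= gp o (p i) (p l) by apply: ppm => //; near: l; exists m.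
have ql : K + delta <= gp o (p l) (q j).
  by apply: le_trans (nK j nj) _; near: l.
have := hyperbolic_ge pl ql; lra.
Unshelve. all: by end_near. Qed.

(** A fixed point [b] close to [a] would also be close to the image of [a] under [c], which is
    separated from [a]. *)
Lemma open_moved c : open [set a : boundary S | bact c a <> a].
Proof.
rewrite boundary_openE => a /= ca o.
have [x xa] := converges_ex a.
have [C xC] := boundary_separated o ca (converges_act c xa) xa.
(* The displacement of [o] pays for moving the base point by [c], [2 * delta] for the chain [c x],
   [c y], [y], [x], and 1 gives strictness. *)
pose r := Num.max 0 (C + mdist o (alpha c o) + 2 * delta + 1).
exists r => [|b]; first by rewrite le_max lexx.
rewrite /boundary_nbhd /= => rab cb; have [y yb] := converges_ex b.
have cyb : converges_to (fun k => alpha c (y k)) b.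
  by rewrite -[b in converges_to _ b]cb; exact: converges_act.
have xy := boundary_product_gt xa yb rab.
have yy := converges_near o r cyb yb.
near \oo => i.
have ri : C + mdist o (alpha c o) + 2 * delta + 1 <= r by rewrite le_max lexx orbT.
have xyi : r <= gp o (x i) (y i) by near: i.
have cxC : gp o (alpha c (x i)) (x i) <= C by near: i.
have cxy : r - mdist o (alpha c o) <= gp o (alpha c (x i)) (alpha c (y i)).
  rewrite gromov_product_actV -mdist_actV.
  have := gromov_product_base o (alpha c^-1%g o) (x i) (y i); lra.
have cyy : r - mdist o (alpha c o) <= gp o (alpha c (y i)) (y i).
  have : r <= gp o (alpha c (y i)) (y i) by near: i.
  have := mdist_ge0 o (alpha c o); lra.
have yx : r - mdist o (alpha c o) - delta <= gp o (y i) (x i).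
  rewrite gromov_productC; have := mdist_ge0 o (alpha c o).
  by move: delta_ge0; lra.
have := hyperbolic_ge (hyperbolic_ge cxy cyy) yx; lra.
Unshelve. all: by end_near. Qed.

(** * Fixed boundary points and the ends of a loxodromic element *)

Lemma boundary_actV_fixed g a : bact g a = a -> bact g^-1%g a = a.
Proof.
by move=> ga; rewrite -[a in bact _ a]ga -boundary_actM mulVg boundary_act1.
Qed.

Lemma expgz_fixed g a (n : int) : bact g a = a -> bact (expgz g n) a = a.
Proof.
move=> ga; have gVa := boundary_actV_fixed ga.
elim/int_ind: n => [|n IHn|n IHn]; first exact: boundary_act1.
  by rewrite -addn1 PoszD addrC expgz_succ boundary_actM IHn.
have -> : (- n.+1%:Z)%R = (- 1 + - n%:Z)%R by rewrite -addn1 PoszD opprD addrC.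
by rewrite expgz_pred boundary_actM IHn.
Qed.

(** A point [z] close to both ends would make the ends close to each other. *)
Lemma either_far o z a b p q C : converges_to p a -> converges_to q b ->
  (\forall i \near \oo, gp o (p i) (q i) <= C) ->
  (\forall i \near \oo, gp o (p i) z <= C + 2 * delta) \/
  (\forall i \near \oo, gp o (q i) z <= C + 2 * delta).
Proof.
move=> pa qb pqC.
have [pC|pC] := converges_dichotomy o z (C + delta) pa; [left|right].
  by near=> i; have : gp o (p i) z <= C + delta + delta;
    [near: i|lra].
near=> i.
have : gp o (p i) (q i) <= C by near: i.
have : C + delta < gp o (p i) z by near: i.
move=> lo /(hyperbolic_le z)[|]; rewrite ?(gromov_productC _ z);
  by move: delta_ge0; lra.
Unshelve. all: by end_near. Qed.

(** Since [h] preserves both ends, they remain separated when seen from [h o]; [either_far] then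
    applies with base point [h o] and third point [o]. A bounded product there means that [h o] lies
    roughly between [o] and that end. *)
Lemma near_one_end h o a b p q C : converges_to p a -> converges_to q b ->
  bact h a = a -> bact h b = b ->
  (\forall i \near \oo, gp o (p i) (q i) <= C) ->
  (\forall i \near \oo, gp (alpha h o) (p i) o <= C + 2 * delta + 2 * delta) \/
  (\forall i \near \oo, gp (alpha h o) (q i) o <= C + 2 * delta + 2 * delta).
Proof.
move=> pa qb ha hb pqC.
have hpa : converges_to (fun k => alpha h^-1%g (p k)) a.
  by rewrite -[a in converges_to _ a](boundary_actV_fixed ha); exact: converges_act.
have hqb : converges_to (fun k => alpha h^-1%g (q k)) b.
  by rewrite -[b in converges_to _ b](boundary_actV_fixed hb); exact: converges_act.
have pp := converges_near o (C + 4 * delta + 1) pa hpa.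
have qq := converges_near o (C + 4 * delta + 1) hqb qb.
have pqC' : \forall i \near \oo, gp (alpha h o) (p i) (q i) <= C + 2 * delta.
  near=> i.
  have : gp o (p i) (q i) <= C by near: i.
  move=> /(hyperbolic_le (alpha h^-1%g (p i)))[pC|].
    have : C + 4 * delta + 1 <= gp o (p i) (alpha h^-1%g (p i)) by near: i.
    by move: delta_ge0; lra.
  move=> /(hyperbolic_le (alpha h^-1%g (q i)))[|qC].
    by rewrite gromov_product_actV invgK; lra.
  have : C + 4 * delta + 1 <= gp o (alpha h^-1%g (q i)) (q i) by near: i.
  by move: delta_ge0; lra.
exact: either_far pa qb pqC'.
Unshelve. all: by end_near. Qed.

(** Translating the first bound by the inverse of [h] bounds a product seen from [o]; the second
    bounds the complementary one, and the two add up to the displacement. So an element with large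
    displacement cannot move [o] towards the same end in both directions. *)
Lemma near_end_inv h o a p D : converges_to p a -> bact h a = a ->
  (\forall i \near \oo, gp (alpha h o) (p i) o <= D) ->
  (\forall i \near \oo, gp (alpha h^-1%g o) (p i) o <= D) ->
  mdist o (alpha h o) <= 2 * D + delta.
Proof.
move=> pa ha pD pD'; have hVa := boundary_actV_fixed ha.
have hpa : converges_to (fun k => alpha h^-1%g (p k)) a.
  by rewrite -[a in converges_to _ a]hVa; exact: converges_act.
have hpD : \forall i \near \oo,
    gp o (alpha h^-1%g (p i)) (alpha h^-1%g o) <= D.
  by near=> i; rewrite gromov_product_actV invgK; near: i.
have pVD := converges_change_le hpa pa hpD.
near \oo => i.
have : gp o (p i) (alpha h^-1%g o) <= D + delta by near: i.
have : gp (alpha h^-1%g o) (p i) o <= D by near: i.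
have := gromov_product_swap o (p i) (alpha h^-1%g o); rewrite mdist_actV.
by lra.
Unshelve. all: by end_near. Qed.

Lemma unbounded_power g o K : loxodromic alpha g ->
  exists n : int, K < mdist o (alpha (expgz g n) o).
Proof.
move=> [unbounded _]; apply: contrapT => N; apply: (unbounded o).
have NK h : cyclic_subgroup g h -> mdist o (alpha h o) <= K.
  by move=> [n _ <-]; rewrite leNgt; apply/negP => ?; apply: N; exists n.
exists (K + K) => _ _ [h /NK hK <-] [h' /NK hK' <-].
have := metric_triangle (alpha h o) o (alpha h' o).
by rewrite (metric_sym (alpha h o) o); lra.
Qed.

(* As [g] fixes both ends of a line, its powers move the base point coarsely
   along this line: [g ^ n o] is close to one of the ends and [g ^ - n o] to the
   other one. *)
Lemma loxodromic_limits g o : loxodromic alpha g ->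
  exists a b t, [/\ a <> b, bact g a = a, bact g b = b,
    converges_to (fun k => alpha (t k) o) a &
    converges_to (fun k => alpha (t k)^-1%g o) b].
Proof.
move=> lox; have [_ [a [b [ab fixE]]]] := lox.
have gen : cyclic_subgroup g g by exists 1%R.
have ga : bact g a = a.
  have : fixed_points (boundary_action alpha) (cyclic_subgroup g) a.
    by rewrite fixE; left.
  exact.
have gb : bact g b = b.
  have : fixed_points (boundary_action alpha) (cyclic_subgroup g) b.
    by rewrite fixE; right.
  exact.
have [p pa] := converges_ex a; have [q qb] := converges_ex b.
have [C pqC] := boundary_separated o ab pa qb.
pose D := C + 2 * delta + 2 * delta.
pose E r h := \forall i \near \oo, gp (alpha h o) (r i) o <= D.
have far r h k : E r h -> k%:R + D <= mdist o (alpha h o) ->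
    \forall i \near \oo, k%:R <= gp o (r i) (alpha h o).
  move=> Erh kd; near=> i.
  have : gp (alpha h o) (r i) o <= D by near: i.
  have := gromov_product_swap o (r i) (alpha h o); lra.
have ex k : exists h, [/\ E p h, E q h^-1%g & k%:R + D <= mdist o (alpha h o)].
  (* The first threshold rules out, by [near_end_inv], that a power and its inverse move [o] towards
     the same end; the second makes the product with the end at least [k]. *)
  have [n] := unbounded_power o (Num.max (2 * D + delta) (k%:R + D)) lox.
  rewrite gt_max => /andP[Dn kn].
  have na := expgz_fixed n ga; have nb := expgz_fixed n gb.
  move: (expgz g n) na nb Dn kn => h ha hb Dh kh.
  have hVa := boundary_actV_fixed ha.
  have hVb := boundary_actV_fixed hb.
  have [Eph|Eqh] := near_one_end pa qb ha hb pqC;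
  have [Eph'|Eqh'] := near_one_end pa qb hVa hVb pqC.
  - by have := near_end_inv pa ha Eph Eph'; rewrite leNgt Dh.
  - by exists h; split=> //; exact: ltW.
  - by exists h^-1%g; rewrite invgK mdist_actV; split=> //; exact: ltW.
  - by have := near_end_inv qb hb Eqh Eqh'; rewrite leNgt Dh.
have [t tP] := choice ex; exists a, b, t; split=> //.
  apply: (@converges_from_near o p) pa _ => k; have [Ep _ kd] := tP k.
  exact: far Ep kd.
apply: (@converges_from_near o q) qb _ => k; have [_ Eq kd] := tP k.
by apply: far Eq _ => //; rewrite mdist_actV.
Unshelve. all: by end_near. Qed.

(** * Moved limit points and axes with both ends in an open set *)

Lemma open_all_moved (B : seq G) :
  open [set a : boundary S | forall c, c \in B -> bact c a <> a].
Proof.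
elim: B => [|c B IHB].
  suff -> : [set a : boundary S | forall c, c \in [::] -> bact c a <> a] = setT.
    exact: openT.
  by apply/seteqP; split.
suff -> : [set a : boundary S | forall c0, c0 \in c :: B -> bact c0 a <> a] =
    [set a | bact c a <> a] `&` [set a | forall c, c \in B -> bact c a <> a].
  by apply: openI => //; exact: open_moved.
apply/seteqP; split=> a /=.
  by move=> aB; split=> [|d dB]; apply: aB; rewrite inE ?eqxx// dB orbT.
by move=> [ca aB] d; rewrite inE => /predU1P[->//|]; exact: aB.
Qed.

(** By induction, the limit points moved by the elements treated so far form a nonempty open set,
    which topological freeness prevents from lying in the fixed set of the next element. *)
Lemma limit_point_moved (B : seq G) : topologically_free (limit_action alpha) ->
  limit_set alpha !=set0 -> (forall c, c \in B -> c <> 1%g) ->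
  exists2 a, limit_set alpha a & forall c, c \in B -> bact c a <> a.
Proof.
move=> free [a0 La0]; elim: B => [|c B IHB] B1; first by exists a0.
have [|a La aB] := IHB; first by move=> d dB; apply: B1; rewrite inE dB orbT.
pose V : set (limit_set alpha) :=
  val @^-1` [set a : boundary S | forall c, c \in B -> bact c a <> a].
have oV : open V by exists [set a | forall c, c \in B -> bact c a <> a] => //;
  exact: open_all_moved.
have [Vc|] := pselect (V `<=` fixed_points (limit_action alpha) [set c]).
  have : (fixed_points (limit_action alpha) [set c])^° (exist _ a (mem_set La)).
    by move: Vc; rewrite open_subsetE// => Vc; apply: Vc; exact: aB.
  by rewrite (free c)//; apply: B1; rewrite inE eqxx.
move=> /existsNP[x /not_implyP[Vx cx]]; exists (val x); first exact: set_valP.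
move=> d; rewrite inE => /predU1P[->|]; last exact: Vx.
by move=> dx; apply: cx => _ ->; apply: val_inj.
Qed.

Lemma loxodromic_in_open (U : set (boundary S)) a :
  general_type alpha -> open U -> limit_set alpha a -> U a ->
  exists o b b' t, [/\ U b, U b', converges_to (fun k => alpha (t k) o) b &
    converges_to (fun k => alpha (t k)^-1%g o) b'].
Proof.
move=> [_ [f [h [loxf loxh fh0]]]]; rewrite boundary_openE => oU.
move=> [s [x [xs xa]]] Ua; have [r r0 rU] := oU a Ua s.
have [f1 [f2 [tf [_ ff1 ff2 tf1 tf2]]]] := loxodromic_limits s loxf.
have [h1 [h2 [th [_ hh1 hh2 th1 th2]]]] := loxodromic_limits s loxh.
have fh b b' : bact f b = b -> bact h b' = b' -> b <> b'.
  move=> fb hc bc; suff : (set0 : set (boundary S)) b by [].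
  by rewrite -fh0; split=> _ ->//; rewrite bc.
have [C11 far11] := boundary_separated s (fh _ _ ff1 hh1) tf1 th1.
have [C12 far12] := boundary_separated s (fh _ _ ff1 hh2) tf1 th2.
have [C21 far21] := boundary_separated s (fh _ _ ff2 hh1) tf2 th1.
have [C22 far22] := boundary_separated s (fh _ _ ff2 hh2) tf2 th2.
pose C := Num.max (Num.max C11 C12) (Num.max C21 C22).
(* [D] is the bound of [either_far]; [K] exceeds [r] by more than the loss [2 * delta] of
   [boundary_product_ge]. *)
pose D := C + 2 * delta; pose K := r + 2 * delta + 1.
have [n xxn] := (product_to_inftyP s x x).1 (converges_self xa) (Num.max K (K + D)).
have [g _ gs] := xs n.
(* An end far from [g^-1 s] is sent by [g] close to [g s = x n], hence close to [a]. *)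
have into b p : converges_to p b ->
    (\forall i \near \oo, gp s (p i) (alpha g^-1%g s) <= D) -> U (bact g b).
  move=> pb pD; apply: rU; rewrite /boundary_nbhd /=.
  have gxK : K + D <= mdist s (alpha g s).
    rewrite (metric_sym s) gs; apply: le_trans (gromov_product_le_mdist s (x n) (x n)).
    by apply: le_trans (xxn n n _ _) => //; rewrite le_max lexx orbT.
  apply: (@lt_le_trans _ _ (K - 2 * delta)%:E).
    by rewrite lte_fin /K; lra.
  apply: (boundary_product_ge (z := x n) xa (converges_act g pb)).
    by exists n => // i /= ni; apply: le_trans (xxn i n _ _) => //; rewrite le_max lexx.
  near=> i; rewrite -gs gromov_product_actV.
  have : gp s (p i) (alpha g^-1%g s) <= D by near: i.
  have := gromov_product_swap s (p i) (alpha g^-1%g s); rewrite mdist_actV; lra.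
have conj b b' t : converges_to (fun k => alpha (t k) s) b ->
    converges_to (fun k => alpha (t k)^-1%g s) b' ->
    (\forall i \near \oo, gp s (alpha (t i) s) (alpha g^-1%g s) <= D) ->
    (\forall i \near \oo, gp s (alpha (t i)^-1%g s) (alpha g^-1%g s) <= D) ->
    exists o b b' t, [/\ U b, U b', converges_to (fun k => alpha (t k) o) b &
      converges_to (fun k => alpha (t k)^-1%g o) b'].
  move=> tb tc /(into _ _ tb) Ub /(into _ _ tc) Uc.
  (* Conjugation by [g], with base point [g s], translates both limits by [g]. *)
  exists (alpha g s), (bact g b), (bact g b'), (fun k => g * t k * g^-1)%g.
  split=> //.
    under eq_fun do rewrite !actM -(actM _ g^-1%g) mulVg act1.
    exact: converges_act.
  under eq_fun do rewrite !invgM invgK !actM -(actM _ g^-1%g) mulVg act1.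
  exact: converges_act.
have farD Cij (p q : nat -> S) : Cij <= C ->
    (\forall i \near \oo, gp s (p i) (q i) <= Cij) ->
    \forall i \near \oo, gp s (p i) (q i) <= C.
  by move=> CC pq; near=> i; apply: le_trans CC; near: i.
have {}far11 : \forall i \near \oo, gp s (alpha (tf i) s) (alpha (th i) s) <= C.
  by apply: farD far11; rewrite !le_max lexx.
have {}far12 : \forall i \near \oo, gp s (alpha (tf i) s) (alpha (th i)^-1%g s) <= C.
  by apply: farD far12; rewrite !le_max lexx orbT.
have {}far21 : \forall i \near \oo, gp s (alpha (tf i)^-1%g s) (alpha (th i) s) <= C.
  by apply: farD far21; rewrite !le_max lexx !orbT.
have {}far22 : \forall i \near \oo,
    gp s (alpha (tf i)^-1%g s) (alpha (th i)^-1%g s) <= C.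
  by apply: farD far22; rewrite !le_max lexx !orbT.
(* Each end of [f] is separated from each end of [h]; if [z] is not far from some end of [f], it is
   far from both ends of [h]. *)
pose z := alpha g^-1%g s.
have [f1D|h1D] := either_far z tf1 th1 far11.
  have [f2D|h1D] := either_far z tf2 th1 far21; first exact: conj _ _ _ tf1 tf2 f1D f2D.
  have [f2D|h2D] := either_far z tf2 th2 far22; first exact: conj _ _ _ tf1 tf2 f1D f2D.
  exact: conj _ _ _ th1 th2 h1D h2D.
have [f1D|h2D] := either_far z tf1 th2 far12; last exact: conj _ _ _ th1 th2 h1D h2D.
have [f2D|h2D] := either_far z tf2 th2 far22; first exact: conj _ _ _ tf1 tf2 f1D f2D.
exact: conj _ _ _ th1 th2 h1D h2D.
Unshelve. all: by end_near. Qed.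

(** * Ping-pong *)

(** If [y] is close to [s o], then [c y] is close to [c s o], which is far from [s o]. So [c y] is
    far from [s o], and the inverse of [s] sends it close to [s^-1 o]. *)
Lemma ping_pong_step o y s c C K :
  mdist o (alpha c o) <= C -> gp o (alpha s o) (alpha c (alpha s o)) <= C ->
  2 * C + delta < K -> K + C + delta <= mdist o (alpha s o) ->
  K <= gp o y (alpha s o) ->
  K <= gp o (alpha s^-1%g (alpha c y)) (alpha s^-1%g o).
Proof.
move=> cC scC CK Ks yK; rewrite gromov_product_actV invgK.
have cyK : K - C <= gp o (alpha c y) (alpha c (alpha s o)).
  rewrite gromov_product_actV.
  by have := gromov_product_base o (alpha c^-1%g o) y (alpha s o);
    rewrite mdist_actV; lra.
have := gromov_product_swap o (alpha c y) (alpha s o).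
have [] := hyperbolic_le (alpha c y) scC; last by lra.
by rewrite gromov_productC; lra.
Qed.

Lemma ping_pong o a b t (B : seq G) :
  converges_to (fun k => alpha (t k) o) a ->
  converges_to (fun k => alpha (t k)^-1%g o) b ->
  (forall c, c \in B -> bact c a <> a /\ bact c b <> b) ->
  forall K, exists g (A A' : set S), [/\ A' (alpha g^-1%g o),
    forall c y, c \in B -> A' y -> A (alpha g (alpha c y)),
    forall c y, c \in B -> A y -> A' (alpha g^-1%g (alpha c y)) &
    forall y, A y -> K <= mdist y o].
Proof.
move=> ta tb Bab K.
have [C BC] : exists C, \forall k \near \oo, forall c, c \in B ->
    [/\ mdist o (alpha c o) <= C,
        gp o (alpha (t k) o) (alpha c (alpha (t k) o)) <= C &
        gp o (alpha (t k)^-1%g o) (alpha c (alpha (t k)^-1%g o)) <= C].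
  elim: B Bab => [|c B IHB] Bab; first by exists 0; near=> k.
  have [|C BC] := IHB; first by move=> d dB; apply: Bab; rewrite inE dB orbT.
  have [|/nesym ca /nesym cb] := Bab c; first by rewrite inE eqxx.
  have [C1 aC1] := boundary_separated o ca ta (converges_act c ta).
  have [C2 bC2] := boundary_separated o cb tb (converges_act c tb).
  exists (Num.max (Num.max C (mdist o (alpha c o))) (Num.max C1 C2)).
  near=> k => d; rewrite inE !le_max => /predU1P[->|dB].
    rewrite lexx orbT; split=> //.
      have -> : gp o (alpha (t k) o) (alpha c (alpha (t k) o)) <= C1 by near: k.
      by rewrite !orbT.
    suff -> : gp o (alpha (t k)^-1%g o) (alpha c (alpha (t k)^-1%g o)) <= C2.
      by rewrite !orbT.
    by near: k.
  have [-> -> ->//] : [/\ mdist o (alpha d o) <= C,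
    gp o (alpha (t k) o) (alpha d (alpha (t k) o)) <= C &
    gp o (alpha (t k)^-1%g o) (alpha d (alpha (t k)^-1%g o)) <= C].
  by move: d dB; near: k.
(* [K] gives the distance bound on [A], and the other term the strict inequality of
   [ping_pong_step]. *)
pose K' := Num.max K (2 * C + delta + 1).
have KK' : K <= K' by rewrite le_max lexx.
have CK' : 2 * C + delta < K'.
  by have : 2 * C + delta + 1 <= K'; [rewrite le_max lexx orbT|lra].
have tK := converges_near o (K' + C + delta) ta ta.
have tVK := converges_near o K' tb tb.
near \oo => k.
have kK : K' + C + delta <= mdist o (alpha (t k) o).
  rewrite metric_sym.
  apply: le_trans (gromov_product_le_mdist o (alpha (t k) o) (alpha (t k) o)).
  by near: k.
have kC c : c \in B -> [/\ mdist o (alpha c o) <= C,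
    gp o (alpha (t k) o) (alpha c (alpha (t k) o)) <= C &
    gp o (alpha (t k)^-1%g o) (alpha c (alpha (t k)^-1%g o)) <= C].
  by move: c; near: k.
exists (t k), [set y | K' <= gp o y (alpha (t k) o)],
  [set y | K' <= gp o y (alpha (t k)^-1%g o)]; split=> /=.
- by near: k.
- move=> c y /kC[c1 c2 c3] yK.
  have := ping_pong_step c1 c3 CK' _ yK; rewrite invgK; apply.
  by rewrite mdist_actV.
- by move=> c y /kC[c1 c2 c3] yK; exact: ping_pong_step c1 c2 CK' kK yK.
- move=> y yK; apply: le_trans KK' (le_trans yK _).
  by rewrite gromov_productC; exact: gromov_product_le_mdist.
Unshelve. all: by end_near. Qed.

End Action.
End Hyperbolicity.

(** The point [o] depends only on [B], so [K] may be chosen afterwards, beyond the displacement of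
    [o] by any given finite set. *)
Lemma lim_free_ping_pong (R : realType) (G : groupType) : lim_free R G ->
  exists (S : metricType R) (alpha : isometric_action G S),
  forall B : seq G, (forall c, c \in B -> c <> 1%g) ->
  exists o, forall K : R, exists g (A A' : set S), [/\ A' (alpha g^-1%g o),
    forall c y, c \in B -> A' y -> A (alpha g (alpha c y)),
    forall c y, c \in B -> A y -> A' (alpha g^-1%g (alpha c y)) &
    forall y, A y -> (K <= mdist y o)%R].
Proof.
move=> [S [alpha [[_ [delta delta_ge0 hyp]] gen free]]]; exists S, alpha => B B1.
have [_ [f [_ [loxf _ _]]]] := gen; have [_ [a0 _]] := loxf.
have [x _ _] := bclassP a0; have o : S := x 0%N.
have L0 : limit_set alpha !=set0.
  have [a [b [t [_ _ _ ta _]]]] := loxodromic_limits delta_ge0 hyp o loxf.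
  by exists a, o, (fun k => alpha (t k) o); split=> // n; exists (t n).
have [a La aB] := limit_point_moved delta_ge0 hyp free L0 B1.
have [p [b [b' [t [bB b'B tb tb']]]]] := loxodromic_in_open delta_ge0 hyp gen
  (open_all_moved delta_ge0 hyp (alpha := alpha) (B := B)) La aB.
exists p; apply: (ping_pong delta_ge0 hyp tb tb') => c cB.
by split; [exact: bB|exact: b'B].
Qed.

(** * Reduced forms of words in one variable *)

Section Words.
Variable G : groupType.
Local Open Scope group_scope.
Implicit Types (g n a : G) (l : seq (bool * G)) (e : bool).

Definition signed g e := if e then g else g^-1.

(* The value at [t = g] of [t ^ e_1 * a_1 * ... * t ^ e_m * a_m], where
   [e_i = 1] or [e_i = -1]. *)
Fixpoint signed_eval g l : G :=
  if l is (e, a) :: l' then signed g e * a * signed_eval g l' else 1.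

Definition no_cancel (x y : bool * G) := (x.1 == y.1) || (x.2 != 1).

(** The reduced form is kept at the level of functions of [g]: the same [a] and [l] serve every
    [g]. *)
Definition reducible_to (f : G -> G) := exists a l,
  sorted no_cancel l /\ forall g, f g = a * signed_eval g l.

Lemma reducible_mulc a f : reducible_to f -> reducible_to (fun g => a * f g).
Proof.
by move=> [b [l [sl fE]]]; exists (a * b), l; split=> // g; rewrite fE mulgA.
Qed.

(** The new factor cancels the leading one when the signs are opposite and the constant is 1;
    otherwise the constant becomes its coefficient. *)
Lemma reducible_mulX e f :
  reducible_to f -> reducible_to (fun g => signed g e * f g).
Proof.
move=> [a [l [sl fE]]].
have [[b [l' [lE a1]]]|N] :=
    pselect (exists b l', l = (~~ e, b) :: l' /\ a = 1).
  exists b, l'; split=> [|g]; first by move: sl; rewrite lE; exact: path_sorted.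
  by rewrite fE lE a1 mul1g /= !mulgA; case: e {lE} => /=;
    rewrite /signed/= ?mulgV ?mulVg mul1g.
exists 1, ((e, a) :: l); split=> [|g]; last by rewrite mul1g fE /= mulgA.
case: l sl N {fE} => //= -[e' b] l sl N; rewrite sl andbT /no_cancel /=.
case: (e =P e') => //= ee'; apply/eqP => a1; apply: N; exists b, l.
by split=> //; case: e e' ee' {sl} => -[].
Qed.

Lemma reducible_expgz (n : int) f :
  reducible_to f -> reducible_to (fun g => expgz g n * f g).
Proof.
move=> rf; elim/int_ind: n => [|n IHn|n IHn].
- by have := reducible_mulc 1 rf.
- have := reducible_mulX true IHn; congr reducible_to; apply/funext => g.
  by rewrite mulgA -expgz_succ -addn1 PoszD addrC.
- have := reducible_mulX false IHn; congr reducible_to; apply/funext => g.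
  by rewrite mulgA -expgz_pred -addn1 PoszD opprD addrC.
Qed.

Lemma word_evalM g (v w : free_product G infinite_cyclic) :
  word_eval g (v * w) = word_eval g v * word_eval g w.
Proof. exact: fp_liftM. Qed.

Lemma reducible_word (w : free_product G infinite_cyclic) :
  reducible_to (fun g => word_eval g w).
Proof.
rewrite -(fp_classK w); elim: (repr w) => [|x u IHu].
  exists 1, [::]; split=> // g; apply: (mulgI (word_eval g 1)).
  by rewrite -word_evalM !mulg1.
rewrite -cat1s -fp_class_cat.
under [X in reducible_to X]eq_fun do rewrite word_evalM.
case: x => [a|n].
  have := reducible_mulc a IHu; congr reducible_to; apply/funext => g.
  by congr (_ * _); rewrite [RHS]fp_lift_inl.
have := reducible_expgz n IHu; congr reducible_to; apply/funext => g.
by congr (_ * _); rewrite [RHS]fp_lift_inr.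
Qed.

End Words.

Arguments no_cancel {G} x y.

(** * Zariski-closed sets and finite families of words *)

(** The complement of [N] contains a basic neighborhood of [x], a finite intersection of complements
    of solution sets; these solution sets cover [N]. *)
Lemma zariski_closedN (G : groupType) (N : set G) x :
  closed (N : set (zariski G)) -> ~ N x ->
  exists ws : seq (free_product G infinite_cyclic),
    (forall w, w \in ws -> word_eval x w <> 1%g) /\
    forall g, N g -> exists2 w, w \in ws & word_eval g w = 1%g.
Proof.
rewrite -openC => -[D sD DE] Nx.
have : (~` N) x by []; rewrite -DE => -[A DA Ax].
have [W _ WE] := sD A DA.
have AE g : (A : set G) g <-> forall w, w \in finmap.enum_fset W -> word_eval g w <> 1%g.
  by rewrite -WE.
exists (finmap.enum_fset W); split=> [|g Ng]; first exact/AE.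
apply: contrapT => gW; suff : (~` N) g by [].
rewrite -DE; exists A => //; apply/AE => w wW wg; apply: gW.
by exists w.
Qed.

(** * Elements of a normal subgroup that solve none of finitely many words *)

Section Avoidance.
Variables (R : realType) (G : groupType) (S : metricType R).
Variable alpha : isometric_action G S.
Local Open Scope group_scope.
Hypothesis alpha_ping_pong : forall B : seq G, (forall c, c \in B -> c <> 1) ->
  exists o, forall K : R, exists t (A A' : set S), [/\ A' (alpha t^-1 o),
    forall c y, c \in B -> A' y -> A (alpha t (alpha c y)),
    forall c y, c \in B -> A y -> A' (alpha t^-1 (alpha c y)) &
    forall y, A y -> (K <= mdist y o)%R].
Variable N : set G.
Hypothesis normalN : normal_subgroup N.

Lemma normal_commutator t n : N n -> N (t * n * t^-1 * n^-1).
Proof.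
have [_ NM NV NJ] := normalN => Nn; apply: NM; last exact: NV.
by have := NJ n t^-1 Nn; rewrite conjgE invgK mulgA.
Qed.

Lemma displacement_bound o (F : seq G) :
  exists K : R, forall c, c \in F -> (mdist (alpha c o) o < K)%R.
Proof.
elim: F => [|c F [K FK]]; first by exists 0%R.
exists (Num.max K (mdist (alpha c o) o + 1)%R) => d.
rewrite inE lt_max => /predU1P[->|/FK->//].
by rewrite ltrDl ltr01 orbT.
Qed.

Lemma normal_infinite n (F : seq G) : N n -> n <> 1 ->
  exists2 m, N m & m \notin F.
Proof.
move=> Nn n1; have [|o pp] := alpha_ping_pong (B := [:: n]).
  by move=> c; rewrite inE => /eqP->.
(* The commutator times [n] is [t * n * t^-1], which moves [o] into [A]; hence the bound concerns
   [c * n]. *)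
have [K FK] := displacement_bound o [seq c * n | c <- F].
have [t [A [A' [A'o A'A _ AK]]]] := pp K.
exists (t * n * t^-1 * n^-1); first exact: normal_commutator.
apply/negP => /(map_f (fun c => c * n))/FK; rewrite /= mulgVK !actM ltNge.
by rewrite AK//; apply: A'A => //; rewrite inE.
Qed.

Section CommutatorWord.
Variables t n : G.
Local Notation g := (t * n * t^-1 * n^-1).
Implicit Types (e : bool) (x : bool * G) (l : seq (bool * G)).

(* [head_coef] and [tail_coef] are chosen so that both [g] and [g^-1] are of the
   form [head_coef e * (t * n ^ e * t^-1) * tail_coef e]. Hence [t] and [t^-1]
   alternate in a word in [g], whatever the signs of its exponents. *)
Definition head_coef e : G := if e then 1 else n.
Definition tail_coef e : G := if e then n^-1 else 1.
(** The element standing between the last [t^-1] of one factor and the first [t] of the next. *)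
Definition junction x (y : bool * G) : G := tail_coef x.1 * x.2 * head_coef y.1.

Lemma signed_commutator e :
  signed g e = head_coef e * (t * signed n e * t^-1) * tail_coef e.
Proof. by case: e; rewrite /= ?mul1g// /signed !invgM !invgK mulg1 !mulgA. Qed.

Lemma signed_eval_commutator x l :
  (head_coef x.1)^-1 * signed_eval g (x :: l) =
  t * signed n x.1 * t^-1 * (tail_coef x.1 * x.2) * signed_eval g l.
Proof. by case: x => e a; rewrite [signed_eval _ _]/= signed_commutator !mulgA mulVg mul1g. Qed.

(** Read from the right, each [n] or [n^-1] followed by [t] leads from [A'] to [A], and each
    junction followed by [t^-1] leads back. The outer coefficients are stripped so that the product
    starts with [t] and ends with [t^-1]. *)
Lemma commutator_word_orbit (A A' : set S) (B : seq G) x l o :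
  (forall c y, c \in B -> A' y -> A (alpha t (alpha c y))) ->
  (forall c y, c \in B -> A y -> A' (alpha t^-1 (alpha c y))) ->
  A' (alpha t^-1 o) -> (forall e, signed n e \in B) ->
  path [rel x y | junction x y \in B] x l ->
  A (alpha ((head_coef x.1)^-1 * signed_eval g (x :: l))
    (alpha (tail_coef (last x l).1 * (last x l).2)^-1 o)).
Proof.
move=> A'A AA' A'o nB; elim: l x => [|y l IHl] x.
  by rewrite signed_eval_commutator mulg1 -actM mulgK !actM => _; exact: A'A.
move=> /= /andP[xy yl]; have := IHl y yl.
set z := alpha _ o => Az.
suff -> : (head_coef x.1)^-1 * signed_eval g [:: x, y & l] =
    t * signed n x.1 * t^-1 * junction x y *
    ((head_coef y.1)^-1 * signed_eval g (y :: l)).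
  rewrite actM; move: (alpha (_ * signed_eval _ _) z) Az => u Au.
  by rewrite 3!actM; apply: A'A => //; exact: AA' xy Au.
by rewrite signed_eval_commutator /junction !mulgA mulgK.
Qed.

(** For equal signs the junction is [n^-1 * a] or [a * n]; for opposite signs it is [a] or a
    conjugate of [a], and [no_cancel] gives [a <> 1]. *)
Lemma junction_neq1 x y :
  no_cancel x y -> 1 != n -> x.2 != n -> x.2 != n^-1 -> junction x y <> 1.
Proof.
case: x y => [e a] [e' b]; rewrite /no_cancel /junction /= => xy n1 an anV.
case: e e' xy => -[] /= xy; rewrite ?mulg1 ?mul1g => E.
- by move: an; rewrite -(mulVKg n a) E mulg1 eqxx.
- by move/eqP: xy; apply; rewrite -(mulVKg n a) -[_ * a](mulgK n) E mul1g mulgV.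
- by move: xy; rewrite E eqxx.
- by move: anV; rewrite -(mulgK n a) E mul1g eqxx.
Qed.

End CommutatorWord.

Lemma normal_avoids_words n0 (ws : seq (G * seq (bool * G))) :
  N n0 -> n0 <> 1 ->
  (forall w, w \in ws -> sorted no_cancel w.2 /\ (w.2 = [::] -> w.1 <> 1)) ->
  exists2 g, N g & forall w, w \in ws -> w.1 * signed_eval g w.2 <> 1.
Proof.
move=> Nn0 n01 wsP.
(* The choices are made in the order [n], [B], [o], [K], [t], each depending on the previous
   ones. *)
pose coefs := flatten [seq unzip2 w.2 | w <- ws].
have [n Nn] := normal_infinite (1 :: coefs ++ [seq c^-1 | c <- coefs]) Nn0 n01.
rewrite inE mem_cat !negb_or eq_sym => /and3P[n1 ncoef nVcoef].
pose B := [seq c <- signed n true :: signed n false ::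
  [seq tail_coef n e.1 * a * head_coef n e.2 | a <- coefs,
    e <- enum {: bool * bool}] | c != 1].
have [|o pp] := alpha_ping_pong (B := B).
  by move=> c; rewrite mem_filter => /andP[/eqP].
(* A default for [head] and [last], reached only for empty lists, which are treated separately. *)
pose x0 := (true, 1 : G).
have [K wsK] := displacement_bound o
  [seq (w.1 * head_coef n (head x0 w.2).1)^-1 *
     (tail_coef n (last x0 w.2).1 * (last x0 w.2).2)^-1 | w <- ws].
have [t [A [A' [A'o A'A AA' AK]]]] := pp K.
exists (t * n * t^-1 * n^-1); first exact: normal_commutator.
move=> [a [|x l]] wws; have [/= sl a1] := wsP _ wws.
  by rewrite mulg1; exact: a1.
have nB e : signed n e \in B.
  rewrite mem_filter; case: e => /=; rewrite ?inE eqxx ?orbT andbT 1?eq_sym//.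
  by rewrite -(inj_eq invg_inj) invg1 invgK.
have lB : path [rel x y | junction n x y \in B] x l.
  have lcoef : all [pred x | x.2 \in coefs] (x :: l).
    apply/allP => y yl; apply/flattenP; exists (unzip2 (x :: l)).
      exact: (map_f (fun w => unzip2 w.2) wws).
    exact: map_f.
  apply: (sub_in_path _ lcoef sl) => y z; rewrite inE => ycoef _ yz.
  rewrite /= mem_filter; apply/andP; split.
    apply/eqP/junction_neq1 => //; first by apply: contraNneq ncoef => <-.
    by apply: contraNneq nVcoef => yV; apply/mapP; exists y.2; rewrite // yV invgK.
  rewrite !inE; apply/orP; right; apply/orP; right.
  have yzb : (y.1, z.1) \in enum {: bool * bool} by rewrite mem_enum.
  exact: (allpairs_f (fun a (e : bool * bool) =>
    tail_coef n e.1 * a * head_coef n e.2) ycoef yzb).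
have Az := commutator_word_orbit A'A AA' A'o nB lB.
(* If the word were trivial, only its outer coefficients would remain in [Az]; they move [o] by less
   than [K], whereas points of [A] are at distance at least [K]. *)
move=> w1; have := wsK _ (map_f _ wws); rewrite ltNge => /negP; apply.
rewrite /=; apply: AK; move: Az; rewrite -actM; congr (A (alpha (_ * _) o)).
rewrite invgM; congr (_ * _); apply: (mulgI a).
by rewrite mulgV.
Qed.

End Avoidance.

(** * Zariski-closed normal subgroups of a lim-free group *)

Theorem corollary1p3 (R : realType) (G : groupType) :
  weakly_hyperbolic R G -> lim_free R G ->
  ~ exists N : set G,
      [/\ normal_subgroup N, N <> [set 1%g], N <> setT
        & closed (N : set (zariski G))].
Proof.
move=> _ /lim_free_ping_pong[S [alpha pp]] [N [nN N1 NT cN]].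
have [x Nx] : exists x, ~ N x.
  by apply/existsNP => NG; apply: NT; apply/seteqP; split.
have [n Nn n1] : exists2 n, N n & n <> 1%g.
  apply: contrapT => NN; apply: N1; apply/seteqP; split=> [n Nn|_ ->].
    by apply: contrapT => n1; apply: NN; exists n.
  by case: nN.
have [ws [wsx wsN]] := zariski_closedN cN Nx.
have /choice[form formP] (w : free_product G infinite_cyclic) :
    exists al : G * seq (bool * G), sorted no_cancel al.2 /\
      forall g, word_eval g w = (al.1 * signed_eval g al.2)%g.
  by have [a [l al]] := reducible_word w; exists (a, l).
have [|g Ng gws] := normal_avoids_words pp nN (ws := map form ws) Nn n1.
  (* A word with empty list is constant in [g], and its value at [x] is not 1. *)
  move=> _ /mapP[w wws ->]; split=> [|l0 a1]; first exact: (formP w).1.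
  by apply: (wsx w wws); rewrite (formP w).2 l0 a1 mulg1.
have [w wws] := wsN g Ng; rewrite (formP w).2.
exact: gws (map_f _ wws).
Qed.
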